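(* Let $\mathbf{P}\subset\mathbb{C}$ be a Jordan arc and let $A\colon\mathbf{P}\to\mathbb{C}^{n\times n}$, $B\colon\mathbf{P}\to\mathbb{C}^{n\times m}$ be continuous such that $(A(\theta),B(\theta))$ is reachable for every $\theta\in\mathbf{P}$ and the Kronecker indices $\kappa(A(\theta),B(\theta))$ are independent of $\theta\in\mathbf{P}$. Then there exists a restricted feedback transformation $(T,F,S)$ on $\mathbf{P}$ such that the pair $(\tilde A,\tilde B)=(T,F,S)\cdot(A,B)$ is uniformly ensemble reachable.
   Context: A Jordan arc is the image of a continuous injective map from a compact interval into $\mathbb{C}$. For a pair $(A,B)\in\mathbb{C}^{n\times n}\times\mathbb{C}^{n\times m}$ with columns $b_1,\dots,b_m$ of $B$, the Kronecker indices $\kappa(A,B)=(\kappa_1,\dots,\kappa_m)$ are defined as follows: go through the list $b_1,\dots,b_m,Ab_1,\dots,Ab_m,\dots,A^{n-1}b_1,\dots,A^{n-1}b_m$ from left to right and select each vector that is linearly independent of the previously selected ones; the selected vectors are then of the form $b_i,Ab_i,\dots,A^{\kappa_i-1}b_i$ ($i=1,\dots,m$), which defines $\kappa_i$ ($\kappa_i=0$ if $b_i$ is not selected). A restricted feedback transformation on $\mathbf{P}$ is a triple $(T,F,S)$ of continuous maps $T\colon\mathbf{P}\to\mathbb{C}^{n\times n}$, $F\colon\mathbf{P}\to\mathbb{C}^{m\times n}$, $S\colon\mathbf{P}\to\mathbb{C}^{m\times m}$ such that for every $\theta$, $T(\theta)$ is invertible and $S(\theta)$ is upper triangular with all diagonal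 entries equal to $1$. It acts by $(T,F,S)\cdot(A,B)=\big(T(A-BS^{-1}F)T^{-1},\,TBS^{-1}\big)$, pointwise in $\theta$. For continuous $A,B$ on $\mathbf{P}$, the pair $(A,B)$ is uniformly ensemble reachable (from zero) if for every continuous $f\colon\mathbf{P}\to\mathbb{C}^n$ and every $\varepsilon>0$ there exist $T>0$ and a $\theta$-independent input $u$ such that $\sup_{\theta\in\mathbf{P}}\|\varphi(T,0,u)(\theta)-f(\theta)\|<\varepsilon$, where in continuous time ($\partial_t x=A(\theta)x+B(\theta)u(t)$, $x(0,\theta)=0$, $u\in L^1([0,T],\mathbb{C}^m)$) $\varphi(T,0,u)(\theta)=\int_0^Te^{A(\theta)(T-s)}B(\theta)u(s)\,ds$, and in discrete time ($x_{t+1}=A(\theta)x_t+B(\theta)u_t$, $x_0=0$, $T\in\mathbb{N}$, $u_i\in\mathbb{C}^m$) $\varphi(T,0,u)(\theta)=\sum_{k=0}^{T-1}A(\theta)^kB(\theta)u_{T-1-k}$. The result holds for either notion. *)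

(* Defs.v *)
From HB Require Import structures.
From mathcomp Require Import all_boot all_order all_algebra.
From mathcomp Require Import all_classical all_reals all_analysis.
From mathcomp.real_closed Require Export complex.
Import Order.TTheory GRing.Theory Num.Theory.
Import numFieldTopology.Exports numFieldNormedType.Exports.

Set Implicit Arguments.
Unset Strict Implicit.
Unset Printing Implicit Defensive.

Local Open Scope ring_scope.
Local Open Scope classical_set_scope.

(* The complex numbers are R[i] for a real type R; we equip R[i] with the
   metric topology of the numFieldType R[i] (distance |z - w|, i.e. the usual
   topology of C). *)
#[non_forgetful_inheritance]
HB.instance Definition _ (R : realType) := PseudoPointedMetric.copy R[i] (R[i])^o.

Section Defs.
Variable R : realType.
Local Notation C := R[i].

Definition jordan_arc (P : set C) : Prop :=
  exists gamma : R -> C,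
    [/\ {within `[0, 1], continuous gamma},
        (forall x y : R, 0 <= x <= 1 -> 0 <= y <= 1 -> gamma x = gamma y -> x = y)
      & P = gamma @` `[0, 1]].

Definition mx_cont_on (P : set C) (p q : nat) (M : C -> 'M[C]_(p, q)) : Prop :=
  forall (i : 'I_p) (j : 'I_q), {within P, continuous (fun z => M z i j)}.

Section Pair.
Variables (n m : nat).

(* (A,B) is reachable: the columns of B, AB, ..., A^(n-1)B span C^n
   (Kalman rank condition, stated with row spaces of transposes). *)
Definition reachable (A : 'M[C]_n) (B : 'M[C]_(n, m)) : bool :=
  \rank (\sum_(k < n) <<(A ^+ k *m B)^T>>)%MS == n.

Definition kron_vec (A : 'M[C]_n) (B : 'M[C]_(n, m)) (k : nat) (i : 'I_m) : 'rV[C]_n :=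
  (col i (A ^+ k *m B))^T.

(* Span of all vectors preceding A^k b_i in the list
   b_1,..,b_m, Ab_1,..,Ab_m, ..., A^(n-1)b_1,..,A^(n-1)b_m. *)
Definition kron_prev (A : 'M[C]_n) (B : 'M[C]_(n, m)) (k : nat) (i : 'I_m) : 'M[C]_n :=
  (\sum_(k' < n) \sum_(i' < m | (k' < k)%N || ((k' == k :> nat) && (i' < i)%N))
      <<kron_vec A B k' i'>>)%MS.

(* A^k b_i is selected iff it is linearly independent of the previously
   selected vectors, i.e. not in the span of all previous vectors. *)
Definition kron_selected (A : 'M[C]_n) (B : 'M[C]_(n, m)) (k : 'I_n) (i : 'I_m) : bool :=
  ~~ (kron_vec A B k i <= kron_prev A B k i)%MS.

Definition kronecker_indices (A : 'M[C]_n) (B : 'M[C]_(n, m)) (i : 'I_m) : nat :=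
  #|[pred k : 'I_n | kron_selected A B k i]|.

Definition restricted_feedback (P : set C) (T : C -> 'M[C]_n)
    (F : C -> 'M[C]_(m, n)) (S : C -> 'M[C]_m) : Prop :=
  [/\ mx_cont_on P T /\ mx_cont_on P F, mx_cont_on P S,
      (forall th, P th -> T th \in unitmx),
      (forall th, P th -> forall i j : 'I_m, (j < i)%N -> S th i j = 0)
    & (forall th, P th -> forall i : 'I_m, S th i i = 1)].

Definition fb_A (T : C -> 'M[C]_n) (F : C -> 'M[C]_(m, n)) (S : C -> 'M[C]_m)
    (A : C -> 'M[C]_n) (B : C -> 'M[C]_(n, m)) : C -> 'M[C]_n :=
  fun th => T th *m (A th - B th *m invmx (S th) *m F th) *m invmx (T th).
Definition fb_B (T : C -> 'M[C]_n) (F : C -> 'M[C]_(m, n)) (S : C -> 'M[C]_m)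
    (B : C -> 'M[C]_(n, m)) : C -> 'M[C]_(n, m) :=
  fun th => T th *m B th *m invmx (S th).

(* sup_{th in P} ||phi th - f th|| < eps, with the max norm on C^n:
   there is delta < eps bounding all coordinates of the error on P. *)
Definition unif_close (P : set C) (phi f : C -> 'cV[C]_n) (eps : R) : Prop :=
  exists delta : R, delta < eps /\
    forall th, P th -> forall i : 'I_n, `|phi th i 0 - f th i 0| <= delta%:C%C.

Definition reach_disc (A : C -> 'M[C]_n) (B : C -> 'M[C]_(n, m))
    (T : nat) (u : nat -> 'cV[C]_m) : C -> 'cV[C]_n :=
  fun th => \sum_(k < T) (A th ^+ k *m B th *m u (T.-1 - k)%N).

Definition uer_disc (P : set C) (A : C -> 'M[C]_n) (B : C -> 'M[C]_(n, m)) : Prop :=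
  forall f : C -> 'cV[C]_n, mx_cont_on P f ->
  forall eps : R, 0 < eps ->
  exists (T : nat) (u : nat -> 'cV[C]_m), unif_close P (reach_disc A B T u) f eps.

End Pair.

Definition expmx (p : nat) (M : 'M[C]_p) : 'M[C]_p :=
  \matrix_(i, j) limn (fun N : nat => \sum_(k < N) ((M ^+ k) i j / (k`!)%:R)).

Definition cintegrable (g : R -> C) (T : R) : Prop :=
  (@lebesgue_measure R).-integrable `[0, T] (EFin \o (fun s => complex.Re (g s))) /\
  (@lebesgue_measure R).-integrable `[0, T] (EFin \o (fun s => complex.Im (g s))).

Definition cintegral (g : R -> C) (T : R) : C :=
  Complex (Rintegral (@lebesgue_measure R) `[0, T] (fun s => complex.Re (g s)))
          (Rintegral (@lebesgue_measure R) `[0, T] (fun s => complex.Im (g s))).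

Section Cont.
Variables (n m : nat).

Definition reach_cont (A : C -> 'M[C]_n) (B : C -> 'M[C]_(n, m))
    (T : R) (u : R -> 'cV[C]_m) : C -> 'cV[C]_n :=
  fun th => \col_(i < n)
    cintegral (fun s => (expmx ((T - s)%:C%C *: A th) *m B th *m u s) i 0) T.

Definition uer_cont (P : set C) (A : C -> 'M[C]_n) (B : C -> 'M[C]_(n, m)) : Prop :=
  forall f : C -> 'cV[C]_n, mx_cont_on P f ->
  forall eps : R, 0 < eps ->
  exists (T : R) (u : R -> 'cV[C]_m),
    [/\ 0 < T, (forall j : 'I_m, cintegrable (fun s => u s j 0) T)
      & unif_close P (reach_cont A B T u) f eps].

End Cont.
End Defs.

(* Main.v *)
Require Import Defs.
From HB Require Import structures.
From mathcomp Require Import all_boot all_order all_algebra.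
From mathcomp Require Import all_classical all_reals all_analysis.
From mathcomp.real_closed Require Import complex.
From mathcomp Require Import ring lra zify.
Import Order.TTheory GRing.Theory Num.Theory.
Import numFieldTopology.Exports numFieldNormedType.Exports.
Local Open Scope ring_scope.
Local Open Scope classical_set_scope.

(** Constancy of the Kronecker indices [kap] makes the selected vectors a basis that
    depends continuously on the parameter.  Let [l_i] be the functional dual to the last
    vector [A^(kap_i - 1) b_i] of the i-th chain; it kills everything preceding that vector
    in the list, so that [l_i A^k B = 0] for [k + 1 < kap_i], while the rows
    [l_i A^(kap_i - 1) B] form a unit upper triangular matrix [S].  Distribute prescribed
    distinct values [lam_r] over the chains, [kap_i] of them to chain [i], and let [T] have
    the rows [l_i prod_(s <> r) (A - lam_s)] and [F] the rows [l_i prod_s (A - lam_s)], the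
    products being over one chain.  Comparing degrees yields
    [T (A - B S^-1 F) = diag(lam) T], and each row of [T B S^-1] is a standard basis
    vector.  The orbit of [B S^-1 (1,...,1)^T] under the closed loop is mapped by [T] to a
    Vandermonde matrix, hence [T] is invertible.

    Feeding the same scalar input to all channels, uniform reachability becomes
    simultaneous approximation of the entries of [f] by one polynomial evaluated at the
    [lam_r].  As [lam] is free, it is taken real: [t(theta) + 2 r + 2] with [t] the inverse
    of the parametrization of the arc, so Weierstrass' theorem on the real line suffices.
    In continuous time one takes the logarithm of these nodes, and inputs constant on unit
    intervals reproduce polynomials in the nodes up to a nonvanishing factor. *)

Set Implicit Arguments.
Unset Strict Implicit.
Unset Printing Implicit Defensive.

(** * Kronecker indices *)

Section SelectedRank.
Variables (F : fieldType) (n : nat) (I : finType) (h : I -> nat).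
Hypothesis h_inj : injective h.
Variable v : I -> 'rV[F]_n.

(** Induction on [N]: by injectivity of [h] at most one vector enters at each stage, and it raises
    the rank by one exactly when it lies outside the span of the earlier ones. *)
Lemma rank_sum_selected N :
  \rank (\sum_(p | (h p < N)%N) <<v p>>)%MS =
  #|[pred p | (h p < N)%N &&
      ~~ (v p <= \sum_(q | (h q < h p)%N) <<v q>>)%MS]|.
Proof.
elim: N => [|N IH].
  rewrite big_pred0 ?mxrank0; last by move=> p; rewrite ltn0.
  by rewrite eq_card0 // => p; rewrite !inE ltn0.
case: (pickP [pred p | h p == N]) => [p0 /eqP hp0 | noN]; last first.
  have ltE p : (h p < N.+1)%N = (h p < N)%N.
    by have := noN p; rewrite /= ltnS leq_eqVlt => ->.
  under eq_bigl do rewrite ltE.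
  by rewrite IH; apply: eq_card => p; rewrite !inE ltE.
have ltE p : (h p < N.+1)%N && (p != p0) = (h p < N)%N.
  by rewrite -(inj_eq h_inj) hp0 ltnS andbC -ltn_neqAle.
rewrite (bigD1 p0) ?hp0 //=.
under eq_bigl do rewrite ltE.
rewrite (cardD1 p0) !inE hp0 ltnSn andTb.
set U := (\sum_(p | (h p < N)%N) <<v p>>)%MS.
have -> : #|[predD1 [pred p | (h p < N.+1)%N &&
   ~~ (v p <= \sum_(q | (h q < h p)%N) <<v q>>)%MS] & p0]| = \rank U.
  rewrite IH; apply: eq_card => p; rewrite !inE andbA; congr (_ && _).
  by rewrite andbC ltE.
have [v0U|v0U] := boolP (v p0 <= U)%MS.
  rewrite add0n; apply: eqmx_rank; apply/andP; split.
    by rewrite addsmx_sub genmxE v0U submx_refl.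
  exact: addsmxSr.
have ltU : (U < <<v p0>> + U)%MS.
  by rewrite ltmxE addsmxSr addsmx_sub genmxE submx_refl andbT.
apply/eqP; rewrite eqn_leq -[X in _ && X]/(\rank U < _)%N rank_ltmx // andbT.
apply: leq_trans (mxrank_adds_leqif _ _) _.
by rewrite leq_add2r mxrank_gen rank_leq_row.
Qed.

End SelectedRank.

(** [k * m + i] is the position of [A^k b_i] in the list, so precedence in the list becomes an
    inequality between numbers. *)
Lemma ltn_lex m k k' i i' : (i < m)%N -> (i' < m)%N ->
  (k' * m + i' < k * m + i)%N = (k' < k)%N || ((k' == k) && (i' < i)%N).
Proof.
move=> im i'm; case: (ltngtP k' k) => [lt|gt|->] /=; last by rewrite ltn_add2l.
  apply: (@leq_trans (k' * m + m)); first by rewrite ltn_add2l.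
  by rewrite -mulSnr (leq_trans _ (leq_addr _ _)) // leq_mul2r lt orbT.
apply/negbTE; rewrite -leqNgt; apply: (@leq_trans (k * m + m)).
  by rewrite leq_add2l ltnW.
by rewrite -mulSnr (leq_trans _ (leq_addr _ _)) // leq_mul2r gt orbT.
Qed.

Lemma card_ord_ltn n k : (k <= n)%N -> #|[pred j : 'I_n | (j < k)%N]| = k.
Proof.
move=> kn; rewrite -sum1_card -[RHS]card_ord -[in RHS]sum1_card.
by rewrite (big_ord_narrow kn).
Qed.

Lemma downward_closed_card n (D : pred 'I_n) (k : 'I_n) :
  (forall i j : 'I_n, (i <= j)%N -> D j -> D i) ->
  D k = (k < #|[pred j | D j]|)%N.
Proof.
move=> Dd; apply/idP/idP => [Dk|].
  rewrite -[X in (X <= _)%N](@card_ord_ltn n k.+1) //; apply: subset_leq_card.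
  by apply/fintype.subsetP => j; rewrite !inE ltnS => /Dd; apply.
apply: contraLR => nDk; rewrite -leqNgt.
rewrite -[X in (_ <= X)%N](@card_ord_ltn n k); last exact: ltnW.
apply: subset_leq_card; apply/fintype.subsetP => j; rewrite !inE => Dj.
by rewrite ltnNge; apply: contra nDk => kj; exact: Dd Dj.
Qed.

Section Kronecker.
Variables (R : realType) (n m : nat).
Variables (A : 'M[R[i]]_n) (B : 'M[R[i]]_(n, m)).
Local Notation vec := (kron_vec A B).
Local Notation prev := (kron_prev A B).
Local Notation kap := (kronecker_indices A B).

Let h (p : 'I_n * 'I_m) : nat := (p.1 * m + p.2)%N.

Let h_inj : injective h.
Proof.
move=> [k i] [k' i']; rewrite /h /= => hE.
have := ltn_lex k k' (ltn_ord i) (ltn_ord i').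
have := ltn_lex k' k (ltn_ord i') (ltn_ord i).
rewrite hE ltnn eq_sym; case: (ltngtP k k') => //= /val_inj ->.
by case: (ltngtP i i') => //= /val_inj ->.
Qed.

Lemma kron_prevE (k : 'I_n) (i : 'I_m) :
  prev k i = (\sum_(q | (h q < h (k, i))%N) <<vec q.1 q.2>>)%MS.
Proof.
rewrite /kron_prev pair_big_dep /=; apply: eq_bigl => -[k' i'] /=.
by rewrite /h /= ltn_lex.
Qed.

Lemma reachable_sum :
  (\sum_(k < n) <<(A ^+ k *m B)^T>> <= \sum_(q : 'I_n * 'I_m) <<vec q.1 q.2>>)%MS.
Proof.
apply/sumsmx_subP => k _; rewrite genmxE; apply/row_subP => i.
rewrite -tr_col; apply: (sumsmx_sup (k, i)) => //.
by rewrite genmxE submx_refl.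
Qed.

(** Contrapositively, if [A^k b_i] depends on its predecessors, multiplication by [A] carries these
    to predecessors of [A^(k+1) b_i], which is then dependent too. The selected exponents thus form
    an initial segment, whose length is [kap i]. *)
Lemma kron_selected_down (i : 'I_m) (k k' : 'I_n) : (k <= k')%N ->
  kron_selected A B k' i -> kron_selected A B k i.
Proof.
case: k' => k' lk' /=; elim: k' lk' => [|k' IH] lk'.
  by rewrite leqn0 => /eqP k0; rewrite (_ : k = Ordinal lk') //; exact: val_inj.
rewrite leq_eqVlt => /predU1P[kE|].
  by rewrite (_ : k = Ordinal lk') //; exact: val_inj.
rewrite ltnS => kk' sel; apply: (IH (ltnW lk') kk').
apply: contra sel => /= /submxMr sub; have {sub} := sub _ A^T.
have vecS j i' : vec j i' *m A^T = vec j.+1 i'.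
  rewrite /kron_vec -trmx_mul; congr (_^T).
  by rewrite !colE (_ : A ^+ j.+1 = A *m A ^+ j) ?exprS // !mulmxA.
rewrite vecS => /submx_trans; apply.
rewrite /kron_prev sumsmxMr; apply/sumsmx_subP => j _.
rewrite sumsmxMr; apply/sumsmx_subP => i' jP.
rewrite (eqmxMr _ (genmxE _)) vecS.
have ljS : (j.+1 < n)%N.
  by case/orP: jP => [?|/andP[/eqP -> _]]; lia.
apply: (sumsmx_sup (Ordinal ljS)) => //; apply: (sumsmx_sup i').
  by rewrite /= ltnS eqSS.
by rewrite genmxE submx_refl.
Qed.

Lemma kron_selectedE (k : 'I_n) (i : 'I_m) :
  kron_selected A B k i = (k < kap i)%N.
Proof. exact: downward_closed_card (@kron_selected_down i). Qed.

Lemma kronecker_indices_le i : (kap i <= n)%N.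
Proof. by rewrite -[X in (_ <= X)%N]card_ord max_card. Qed.

Hypothesis reachAB : reachable A B.

(** Reachability gives the whole list rank [n], and this rank counts the selected vectors. They can
    therefore be enumerated by ['I_n]. *)
Lemma card_selected : #|[pred p : 'I_n * 'I_m | (p.1 < kap p.2)%N]| = n.
Proof.
have allq (q : 'I_n * 'I_m) : (h q < n * m)%N.
  have := ltn_ord q.2; have := ltn_ord q.1.
  rewrite /h => q1 q2; apply: (@leq_trans (q.1 * m + m)).
    by rewrite ltn_add2l.
  by rewrite -mulSnr leq_mul2r q1 orbT.
have := @rank_sum_selected _ n _ h h_inj (fun q => vec q.1 q.2) (n * m).
under eq_bigl do rewrite allq.
have -> : \rank (\sum_(q : 'I_n * 'I_m) <<vec q.1 q.2>>)%MS = n.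
  apply/eqP; rewrite eqn_leq rank_leq_col /=.
  by have := mxrankS reachable_sum; rewrite (eqP reachAB).
move=> rk; apply: etrans (esym rk); apply: eq_card => -[k i]; rewrite !inE allq /=.
by rewrite -kron_prevE -kron_selectedE.
Qed.

Variable e : 'I_n -> 'I_n * 'I_m.
Hypothesis e_im : forall p : 'I_n * 'I_m, (p.1 < kap p.2)%N = (p \in codom e).

(** The choice of powers and columns is recorded in [e] alone; with [e] fixed, the entries are
    polynomials in those of [A] and [B]. *)
Definition selected_basis : 'M[R[i]]_n := \matrix_r vec (e r).1 (e r).2.

Lemma lex_ind (Q : 'I_n -> 'I_m -> Prop) :
  (forall (k : 'I_n) (i : 'I_m),
     (forall (k' : 'I_n) (i' : 'I_m),
        (k' < k)%N || ((k' == k :> nat) && (i' < i)%N) -> Q k' i') -> Q k i) ->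
  forall k i, Q k i.
Proof.
move=> IH k i; have [N] := ubnP (h (k, i)); elim: N k i => // N IHN k i.
rewrite ltnS => leN; apply: IH => k' i' lt; apply: IHN.
by apply: leq_trans leN; rewrite /h /= ltn_lex.
Qed.

(** By induction along the list every vector lies in the row space: a selected one is a row, any
    other is a combination of its predecessors. Reachability then gives full rank. *)
Lemma selected_basis_unit : selected_basis \in unitmx.
Proof.
rewrite -row_full_unit -sub1mx.
have : row_full (\sum_(k < n) <<(A ^+ k *m B)^T>>)%MS by exact: reachAB.
rewrite -sub1mx => /submx_trans; apply.
apply: (submx_trans reachable_sum); apply/sumsmx_subP => -[k i] _ /=.
rewrite genmxE; move: k i; apply: lex_ind => k i IH.
have [lt|ge] := boolP (k < kap i)%N.
  have := e_im (k, i); rewrite lt => /esym /codomP[r er].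
  have -> : vec k i = row r selected_basis by rewrite rowK -er.
  exact: row_sub.
move: ge; rewrite -kron_selectedE negbK => /submx_trans; apply.
apply/sumsmx_subP => k' _; apply/sumsmx_subP => i' /IH.
by rewrite genmxE.
Qed.

(** An unselected vector is a combination of its predecessors, so vanishing propagates along the
    list from the selected vectors to the others. *)
Lemma dual_functional_prev (l : 'cV[R[i]]_n) (k : 'I_n) (i : 'I_m) :
  (forall (k' : 'I_n) (i' : 'I_m), (k' < kap i')%N ->
     (k' < k)%N || ((k' == k :> nat) && (i' < i)%N) -> vec k' i' *m l = 0) ->
  forall (k' : 'I_n) (i' : 'I_m),
    (k' < k)%N || ((k' == k :> nat) && (i' < i)%N) -> vec k' i' *m l = 0.
Proof.
move=> kill; apply: lex_ind => k' i' IH lt.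
have [sel|nsel] := boolP (k' < kap i')%N; first exact: kill.
apply/eqP; rewrite -sub_kermx.
move: nsel; rewrite -kron_selectedE negbK => /submx_trans; apply.
apply/sumsmx_subP => k'' _; apply/sumsmx_subP => i'' lt'.
rewrite genmxE sub_kermx; apply/eqP; apply: IH => //.
by move: lt lt'; rewrite -!(@ltn_lex m) //; lia.
Qed.

(** [l] is the dual basis vector attached to the end of chain [i]. It kills all other selected
    vectors, hence, by [dual_functional_prev], everything that precedes this end in the list. *)
Lemma dual_row_spec (i : 'I_m) (s : 'I_n) (l := row s (invmx selected_basis)^T) :
  (0 < kap i)%N -> (e s).2 = i -> (e s).1.+1 = kap i ->
  [/\ (forall k, (k.+1 < kap i)%N -> l *m A ^+ k *m B = 0),
      (forall i' : 'I_m, (i' < i)%N -> (l *m A ^+ (kap i).-1 *m B) 0 i' = 0)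
    & (l *m A ^+ (kap i).-1 *m B) 0 i = 1].
Proof.
move=> kap0 es2 es1.
have lvec k i' : (l *m A ^+ k *m B) 0 i' = (vec k i' *m l^T) 0 0.
  by rewrite /kron_vec -trmx_mul [RHS]mxE colE !mulmxA -colE [RHS]mxE.
have dual r : (vec (e r).1 (e r).2 *m l^T) 0 0 = (r == s)%:R.
  have := mulmxV selected_basis_unit => /(congr1 (fun M : 'M[_]_n => M r s)).
  rewrite [RHS]mxE => <-; rewrite !mxE; apply: eq_bigr => j _.
  by rewrite !mxE.
have kn : ((kap i).-1 < n)%N.
  by rewrite -es1 /=.
have sE : e s = (Ordinal kn, i).
  by case: (e s) es1 es2 => a b /= es1 ->; congr (_, _); apply: val_inj; rewrite /= -es1.
have kill (k' : 'I_n) (i' : 'I_m) :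
    (k' < (kap i).-1)%N || ((k' == (kap i).-1 :> nat) && (i' < i)%N) ->
    vec k' i' *m l^T = 0.
  apply: (@dual_functional_prev _ (Ordinal kn) i) => {}k' {}i' sel lt.
  apply/matrixP => a b; rewrite !ord1 [RHS]mxE.
  have := e_im (k', i'); rewrite sel => /esym /codomP[r er].
  have := dual r; rewrite -er => ->; case: eqP => // rs.
  by move: er; rewrite rs sE => -[kE iE]; move: lt; rewrite kE iE /= !ltnn andbF.
split.
- move=> k lt; apply/rowP => i'; rewrite lvec [RHS]mxE.
  have lkn : (k < n)%N by lia.
  by have := @kill (Ordinal lkn) i'; rewrite /= => -> //; rewrite ?mxE //; apply/orP; left; lia.
- by move=> i' lt; rewrite lvec (kill (Ordinal kn)) ?mxE //= eqxx lt orbT.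
- by have := dual s; rewrite sE eqxx lvec.
Qed.

End Kronecker.

(** * The diagonal normal form *)

Section NormalForm.
Variables (R : realType) (n' m : nat).
Local Notation C := R[i].
Local Notation n := n'.+1.
Variables (kap : 'I_m -> nat) (e : 'I_n -> 'I_n * 'I_m).

(** Under the hypotheses imposed below on [e] and [kap], [None] occurs only for an empty chain. *)
Definition chain_last (i : 'I_m) : option 'I_n :=
  [pick s | ((e s).2 == i) && ((e s).1.+1 == kap i)].

Definition chain_dual (A : 'M[C]_n) (B : 'M[C]_(n, m)) (i : 'I_m) : 'rV[C]_n :=
  if chain_last i is Some s then row s (invmx (selected_basis A B e))^T else 0.

Definition shift_prod (A : 'M[C]_n) (lam : 'I_n -> C) (Q : pred 'I_n) : 'M[C]_n :=
  \prod_(r | Q r) (A - (lam r)%:M).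

(** For an empty chain, the row of the identity matrix keeps [S] unit upper triangular. *)
Definition nf_S (A : 'M[C]_n) (B : 'M[C]_(n, m)) : 'M[C]_m :=
  \matrix_i (if chain_last i is Some s
             then row s (invmx (selected_basis A B e))^T *m A ^+ (kap i).-1 *m B
             else row i 1%:M).

Definition nf_F (A : 'M[C]_n) (B : 'M[C]_(n, m)) (lam : 'I_n -> C) : 'M[C]_(m, n) :=
  \matrix_i (chain_dual A B i *m shift_prod A lam [pred r | (e r).2 == i]).

(** Within one chain, [l_i] is multiplied by the unnormalised Lagrange polynomials of the values
    [lam], taken at [A]; one more factor [A - lam_r] yields the row of [nf_F]. *)
Definition nf_T (A : 'M[C]_n) (B : 'M[C]_(n, m)) (lam : 'I_n -> C) : 'M[C]_n :=
  \matrix_r (chain_dual A B (e r).2 *m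
    shift_prod A lam [pred r' | ((e r').2 == (e r).2) && (r' != r)]).

(** This will be [T B S^-1]; it does not depend on the parameter. *)
Definition nf_B : 'M[C]_(n, m) := \matrix_(r, i) ((e r).2 == i)%:R.

Variables (A : 'M[C]_n) (B : 'M[C]_(n, m)) (lam : 'I_n -> C).
Hypothesis reachAB : reachable A B.
Hypothesis kapE : forall i, kronecker_indices A B i = kap i.
Hypothesis e_inj : injective e.
Hypothesis e_im : forall p : 'I_n * 'I_m, (p.1 < kap p.2)%N = (p \in codom e).
Hypothesis lam_inj : injective lam.

Local Notation l := (chain_dual A B).
Local Notation S := (nf_S A B).
Local Notation F := (nf_F A B lam).
Local Notation T := (nf_T A B lam).

Lemma kap_le i : (kap i <= n)%N.
Proof. by rewrite -kapE kronecker_indices_le. Qed.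

(** The first component of [e] maps chain [i] bijectively onto the exponents below [kap i]. This
    fixes the degrees of the products in [nf_F] and [nf_T]. *)
Lemma card_chain i : #|[pred r | (e r).2 == i]| = kap i.
Proof.
rewrite -[RHS](@card_ord_ltn n) ?kap_le //.
rewrite -(@card_in_image _ _ (fun r => (e r).1) [pred r | (e r).2 == i]).
  apply: eq_card => k; rewrite [RHS]inE. apply/fintype.imageP/idP => [[r]|lt].
    rewrite inE => /eqP er ->; have := e_im (e r).
    by rewrite codom_f er => ->.
  have := e_im (k, i); rewrite /= lt => /esym /codomP[r er].
  by exists r; rewrite ?inE -?er.
move=> r s /=; rewrite !inE => /eqP er /eqP es er1; apply: e_inj.
by rewrite [LHS]surjective_pairing er er1 -es -surjective_pairing.
Qed.

Lemma chain_lastP i : (0 < kap i)%N ->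
  exists2 s, chain_last i = Some s & (e s).2 = i /\ (e s).1.+1 = kap i.
Proof.
move=> k0; rewrite /chain_last; case: pickP => [s /andP[/eqP ? /eqP ?]|].
  by exists s.
have lt : ((kap i).-1 < n)%N by have := kap_le i; lia.
have := e_im (Ordinal lt, i); rewrite /= prednK // leqnn => /esym /codomP[s es].
by move=> /(_ s); rewrite -es /= eqxx prednK // eqxx.
Qed.

Lemma chain_last0 i : kap i = 0%N -> chain_last i = None.
Proof. by move=> k0; rewrite /chain_last; case: pickP => // s; rewrite k0 andbF. Qed.

Lemma chain_kap_gt0 r : (0 < kap (e r).2)%N.
Proof. by rewrite (leq_ltn_trans _ (_ : ((e r).1 < _)%N)) ?e_im ?codom_f. Qed.

Lemma chain_dual_spec i : (0 < kap i)%N ->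
  [/\ (forall k, (k.+1 < kap i)%N -> l i *m A ^+ k *m B = 0),
      row i S = l i *m A ^+ (kap i).-1 *m B,
      (forall i' : 'I_m, (i' < i)%N -> S i i' = 0)
    & S i i = 1].
Proof.
move=> k0; have [s sE [es2 es1]] := chain_lastP k0.
have e_im' (p : 'I_n * 'I_m) : (p.1 < kronecker_indices A B p.2)%N = (p \in codom e).
  by rewrite kapE e_im.
have := @dual_row_spec _ _ _ A B reachAB e e_im' i s.
rewrite !kapE => -[] // d1 d2 d3.
have rS : row i S = l i *m A ^+ (kap i).-1 *m B.
  by rewrite rowK /chain_dual sE.
have SE i' : S i i' = (l i *m A ^+ (kap i).-1 *m B) 0 i'.
  by rewrite -rS [RHS]mxE.
rewrite /chain_dual sE in SE rS *; split => //; last by rewrite SE.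
by move=> i' lt; rewrite SE d2.
Qed.

Lemma nf_S_trig (i i' : 'I_m) : (i' < i)%N -> S i i' = 0.
Proof.
move=> lt; case: (posnP (kap i)) => [k0|k0]; last by case: (chain_dual_spec k0) => _ _ + _; apply.
by rewrite mxE (chain_last0 k0) !mxE eq_sym; case: eqP lt => // ->; rewrite ltnn.
Qed.

Lemma nf_S_diag i : S i i = 1.
Proof.
case: (posnP (kap i)) => [k0|k0]; last by case: (chain_dual_spec k0).
by rewrite mxE (chain_last0 k0) !mxE eqxx.
Qed.

Lemma nf_S_unit : S \in unitmx.
Proof.
rewrite unitmxE -det_tr det_trig; last first.
  by apply/is_trig_mxP => i j lt; rewrite mxE nf_S_trig.
by rewrite big1 ?unitr1 // => i _; rewrite mxE nf_S_diag.
Qed.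

Lemma shift_prodE Q : shift_prod A lam Q =
  horner_mx A (\prod_(r | Q r) ('X - (lam r)%:P)).
Proof.
rewrite rmorph_prod; apply: eq_bigr => r _.
by rewrite rmorphB /= horner_mx_X horner_mx_C.
Qed.

(** When [p] is expanded, only the leading term survives, and its coefficient is 1. *)
Lemma monic_horner_dual (x : 'rV[C]_n) (p : {poly C}) k :
  p \is monic -> size p = k.+1 -> (forall j, (j < k)%N -> x *m A ^+ j *m B = 0) ->
  x *m horner_mx A p *m B = x *m A ^+ k *m B.
Proof.
move=> pm sp x0.
rewrite -[p in LHS]coefK poly_def sp rmorph_sum mulmx_sumr mulmx_suml big_ord_recr /=.
have lc : p`_k = 1 by have := monicP pm; rewrite lead_coefE sp.
rewrite big1 ?add0r => [|j _].
  by rewrite lc scale1r rmorphXn /= horner_mx_X.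
by rewrite linearZ rmorphXn /= horner_mx_X -scalemxAr -scalemxAl x0 ?scaler0.
Qed.

(** For [r] in chain [i], the polynomial in row [r] is monic of degree [kap i - 1], so only
    [l_i A^(kap i - 1) B], a row of [S], is left. *)
Lemma nf_TB : T *m B = nf_B *m S.
Proof.
apply/row_matrixP => r; rewrite !row_mul.
have k0 := chain_kap_gt0 r.
have [d1 d2 _ _] := chain_dual_spec k0.
have -> : row r nf_B *m S = row (e r).2 S.
  rewrite [RHS]rowE; congr (_ *m _); apply/rowP => i; rewrite !mxE eqxx /=.
  by rewrite eq_sym.
rewrite rowK d2 shift_prodE; apply: monic_horner_dual.
- exact: monic_prod_XsubC.
- rewrite -big_filter size_prod_XsubC size_filter -sum1_count prednK //.
  rewrite -card_chain (cardD1 r) inE eqxx add1n -sum1_card; congr _.+1.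
  by apply: eq_bigl => r'; rewrite !inE andbC.
- by move=> j lt; apply: d1; lia.
Qed.

Lemma nf_TA : T *m A - nf_B *m F = diag_mx (\row_r lam r) *m T.
Proof.
apply/row_matrixP => r; rewrite linearB /= !row_mul.
have -> : row r nf_B *m F = row (e r).2 F.
  rewrite [RHS]rowE; congr (_ *m _); apply/rowP => i; rewrite !mxE eqxx /=.
  by rewrite eq_sym.
rewrite row_diag_mx -scalemxAl -rowE mxE !rowK /shift_prod.
set Q := \prod_(r' | _) _.
(* Factor [r] is split off among polynomials, where multiplication commutes. Afterwards
   [Q A - Q (A - lam_r) = lam_r Q]. *)
have -> : \prod_(r0 | [pred r0 | (e r0).2 == (e r).2] r0) (A - (lam r0)%:M) =
    Q *m (A - (lam r)%:M).
  have := shift_prodE [pred r0 | (e r0).2 == (e r).2]; rewrite /shift_prod => ->.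
  rewrite (bigD1 r) //= mulrC rmorphM rmorphB /= horner_mx_X horner_mx_C.
  by rewrite -shift_prodE.
by rewrite mulmxBr mulmxBr mulmxA mul_mx_scalar -scalemxAr opprB addrC subrK.
Qed.

(** [TAcl] and [Tb] rest on the invertibility of [S] only. [X] is the controllability matrix of
    [(Acl, b)], and [T X] is a transposed Vandermonde matrix with distinct nodes, so its square
    factor [T] is invertible. *)
Lemma nf_T_unit : T \in unitmx.
Proof.
pose Acl := A - B *m invmx S *m F; pose b := B *m invmx S *m const_mx 1 : 'cV_n.
have TAcl : T *m Acl = diag_mx (\row_r lam r) *m T.
  by rewrite mulmxBr !mulmxA nf_TB mulmxK ?nf_S_unit // nf_TA.
have Tb : T *m b = const_mx 1.
  rewrite !mulmxA nf_TB mulmxK ?nf_S_unit //; apply/colP => r.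
  rewrite !mxE (bigD1 (e r).2) //= !mxE eqxx mul1r big1 ?addr0 // => i.
  by rewrite !mxE eq_sym => /negPf ->; rewrite mul0r.
have TAk k : T *m (Acl ^+ k *m b) = \col_r (lam r ^+ k).
  elim: k => [|k IH]; first by rewrite mul1mx Tb; apply/colP => r; rewrite !mxE expr0.
  rewrite (_ : Acl ^+ k.+1 = Acl *m Acl ^+ k) ?exprS // -mulmxA mulmxA TAcl.
  rewrite -mulmxA IH mul_diag_mx; apply/colP => r.
  by rewrite !mxE exprS.
pose X : 'M[C]_n := \matrix_(s, k) (Acl ^+ k *m b) s 0.
have TX : T *m X = (Vandermonde n (\row_r lam r))^T.
  apply/matrixP => r k; rewrite 2![RHS]mxE [(\row__ _) _ _]mxE [LHS]mxE.
  have := congr1 (fun M : 'M[C]_(n, 1) => M r 0) (TAk k).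
  by rewrite [RHS]mxE [LHS]mxE => <-; apply: eq_bigr => s _; rewrite [X s k]mxE.
have : T *m X \in unitmx.
  rewrite TX unitmx_tr unitmxE det_Vandermonde unitfE.
  apply/prodf_neq0 => i _; apply/prodf_neq0 => j lt.
  rewrite !mxE subr_eq0 (inj_eq lam_inj); apply: contraTN lt => /eqP ->.
  by rewrite ltnn.
by rewrite unitmx_mul => /andP[].
Qed.

Lemma nf_closed_loop_A :
  T *m (A - B *m invmx S *m F) *m invmx T = diag_mx (\row_r lam r).
Proof.
rewrite mulmxBr !mulmxA nf_TB (mulmxK nf_S_unit) nf_TA mulmxK //.
exact: nf_T_unit.
Qed.

Lemma nf_closed_loop_B : T *m B *m invmx S = nf_B.
Proof. by rewrite nf_TB (mulmxK nf_S_unit). Qed.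

End NormalForm.

(** Each row of [nf_B] has a single 1, so a scalar input fed to all channels reaches every
    coordinate unchanged. *)
Lemma nf_B_const (R : realType) n' m (e : 'I_n'.+1 -> 'I_n'.+1 * 'I_m) (x : R[i]) :
  nf_B R e *m const_mx x = const_mx x :> 'cV_n'.+1.
Proof.
apply/colP => r; rewrite !mxE (bigD1 (e r).2) //= !mxE eqxx mul1r big1 ?addr0 // => i.
by rewrite !mxE eq_sym => /negPf ->; rewrite mul0r.
Qed.

(** * Continuous dependence on the parameter *)

Section ContOn.
Variables (R : realType) (P : set R[i]).
Local Notation C := R[i].
Local Notation cont_on f := {within P, continuous (f : C -> C)}.

Lemma cont_onD (f g : C -> C) : cont_on f -> cont_on g -> cont_on (fun z => f z + g z).
Proof. by move=> cf cg z; exact: (@cvgD C C^o _ _ _ _ _ _ _ (cf z) (cg z)). Qed.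

Lemma cont_onM (f g : C -> C) : cont_on f -> cont_on g -> cont_on (fun z => f z * g z).
Proof. by move=> cf cg z; exact: (@cvgM C _ _ _ _ _ _ _ (cf z) (cg z)). Qed.

Lemma cont_on_cst (c : C) : cont_on (fun=> c).
Proof. by move=> z; exact: cvg_cst. Qed.

Lemma eq_cont_on (f g : C -> C) :
  (forall z, P z -> f z = g z) -> cont_on f -> cont_on g.
Proof. by move=> fg; apply: subspace_eq_continuous => z /[!inE]; exact: fg. Qed.

Lemma cont_onV (f : C -> C) : (forall z, P z -> f z != 0) ->
  cont_on f -> cont_on (fun z => (f z)^-1).
Proof.
move=> f0 /subspace_continuousP cf; apply/subspace_continuousP => z Pz.
exact: (@cvgV C _ _ _ _ _ (f0 z Pz) (cf z Pz)).
Qed.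

Lemma cont_on_sum (I : Type) (s : seq I) (Q : pred I) (f : I -> C -> C) :
  (forall i, cont_on (f i)) -> cont_on (fun z => \sum_(i <- s | Q i) f i z).
Proof.
move=> cf; elim: s => [|i s IH].
  by apply: (@eq_cont_on (fun=> 0)) (@cont_on_cst _) => z _; rewrite big_nil.
apply: (@eq_cont_on (fun z => (if Q i then f i z else 0) + \sum_(j <- s | Q j) f j z)).
  by move=> z _; rewrite big_cons; case: (Q i); rewrite ?add0r.
by apply: cont_onD IH; case: (Q i); [exact: cf|exact: cont_on_cst].
Qed.

Lemma cont_on_prod (I : Type) (s : seq I) (Q : pred I) (f : I -> C -> C) :
  (forall i, cont_on (f i)) -> cont_on (fun z => \prod_(i <- s | Q i) f i z).
Proof.
move=> cf; elim: s => [|i s IH].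
  by apply: (@eq_cont_on (fun=> 1)) (@cont_on_cst _) => z _; rewrite big_nil.
apply: (@eq_cont_on (fun z => (if Q i then f i z else 1) * \prod_(j <- s | Q j) f j z)).
  by move=> z _; rewrite big_cons; case: (Q i); rewrite ?mul1r.
by apply: cont_onM IH; case: (Q i); [exact: cf|exact: cont_on_cst].
Qed.

Lemma mx_cont_on_cst p q (M : 'M[C]_(p, q)) : mx_cont_on P (fun=> M).
Proof. by move=> i j; exact: cont_on_cst. Qed.

Lemma mx_cont_onM p q r (M : C -> 'M[C]_(p, q)) (N : C -> 'M[C]_(q, r)) :
  mx_cont_on P M -> mx_cont_on P N -> mx_cont_on P (fun z => M z *m N z).
Proof.
move=> cM cN i j; apply: (@eq_cont_on (fun z => \sum_k M z i k * N z k j)).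
  by move=> z _; rewrite mxE.
by apply: cont_on_sum => k; apply: cont_onM; [exact: cM|exact: cN].
Qed.

Lemma mx_cont_onB p q (M N : C -> 'M[C]_(p, q)) :
  mx_cont_on P M -> mx_cont_on P N -> mx_cont_on P (fun z => M z - N z).
Proof.
move=> cM cN i j; apply: (@eq_cont_on (fun z => M z i j + (-1) * N z i j)).
  by move=> z _; rewrite !mxE mulN1r.
apply: cont_onD; first exact: cM.
by apply: cont_onM; [exact: cont_on_cst|exact: cN].
Qed.

Lemma mx_cont_on_tr p q (M : C -> 'M[C]_(p, q)) :
  mx_cont_on P M -> mx_cont_on P (fun z => (M z)^T).
Proof. by move=> cM i j; apply: (@eq_cont_on (fun z => M z j i)) (cM j i) => z _; rewrite mxE. Qed.

Lemma mx_cont_on_row p q (M : C -> 'M[C]_(p, q)) (i : 'I_p) :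
  mx_cont_on P M -> mx_cont_on P (fun z => row i (M z)).
Proof. by move=> cM k j; apply: (@eq_cont_on (fun z => M z i j)) (cM i j) => z _; rewrite mxE. Qed.

Lemma mx_cont_on_rows p q (x : 'I_p -> C -> 'rV[C]_q) :
  (forall i, mx_cont_on P (x i)) -> mx_cont_on P (fun z => \matrix_i x i z).
Proof. by move=> cx i j; apply: (@eq_cont_on (fun z => x i z 0 j)) (cx i 0 j) => z _; rewrite mxE. Qed.

Lemma mx_cont_on_scalar p (f : C -> C) :
  cont_on f -> mx_cont_on P (fun z => (f z)%:M : 'M[C]_p).
Proof.
move=> cf i j; apply: (@eq_cont_on (fun z => f z * (i == j)%:R)).
  by move=> z _; rewrite !mxE mulr_natr.
by apply: cont_onM; [exact: cf|exact: cont_on_cst].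
Qed.

Lemma mx_cont_onX p (M : C -> 'M[C]_p) k :
  mx_cont_on P M -> mx_cont_on P (fun z => M z ^+ k).
Proof.
move=> cM; elim: k => [|k IH]; first exact: mx_cont_on_cst.
suff -> : (fun z => M z ^+ k.+1) = (fun z => M z *m M z ^+ k) by exact: mx_cont_onM.
by apply/funext => z; rewrite exprS.
Qed.

Lemma cont_on_det p (M : C -> 'M[C]_p) :
  mx_cont_on P M -> cont_on (fun z => \det (M z)).
Proof.
move=> cM; apply: cont_on_sum => s; apply: cont_onM; first exact: cont_on_cst.
by apply: cont_on_prod => i; exact: cM.
Qed.

(** Cramer's rule: the inverse consists of cofactors divided by a nonvanishing determinant. *)
Lemma mx_cont_onV p (M : C -> 'M[C]_p) : (forall z, P z -> M z \in unitmx) ->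
  mx_cont_on P M -> mx_cont_on P (fun z => invmx (M z)).
Proof.
move=> uM cM i j.
apply: (@eq_cont_on (fun z => (\det (M z))^-1 * cofactor (M z) j i)).
  by move=> z Pz; rewrite /invmx uM // !mxE.
apply: cont_onM.
  apply: cont_onV (cont_on_det cM) => z Pz.
  by rewrite -unitfE -unitmxE uM.
apply: cont_onM; first exact: cont_on_cst.
by apply: cont_on_det => k l; apply: (@eq_cont_on (fun z => M z (lift j k) (lift i l))) (cM _ _) => z _; rewrite !mxE.
Qed.

End ContOn.

(** * Continuity of the normal form in the parameter *)

Section NormalFormCont.
Variables (R : realType) (P : set R[i]) (n' m : nat).
Local Notation C := R[i].
Local Notation n := n'.+1.
Variables (kap : 'I_m -> nat) (e : 'I_n -> 'I_n * 'I_m).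
Variables (A : C -> 'M[C]_n) (B : C -> 'M[C]_(n, m)) (lam : 'I_n -> C -> C).
Hypothesis cA : mx_cont_on P A.
Hypothesis cB : mx_cont_on P B.
Hypothesis clam : forall r, {within P, continuous (lam r)}.
Hypothesis basis_unit : forall z, P z -> selected_basis (A z) (B z) e \in unitmx.

Lemma mx_cont_on_invbasis : mx_cont_on P (fun z => invmx (selected_basis (A z) (B z) e)).
Proof.
apply: mx_cont_onV; first exact: basis_unit.
apply: mx_cont_on_rows => r; apply: mx_cont_on_tr.
have cAB : mx_cont_on P (fun z => A z ^+ (e r).1 *m B z).
  by apply: mx_cont_onM; [exact: mx_cont_onX|exact: cB].
move=> i j; refine (eq_cont_on _ (cAB i (e r).2)).
by move=> z _; rewrite [RHS]mxE.
Qed.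

Lemma mx_cont_on_dual i : mx_cont_on P (fun z => chain_dual kap e (A z) (B z) i).
Proof.
rewrite /chain_dual; case: chain_last => [s|]; last exact: mx_cont_on_cst.
exact/mx_cont_on_row/mx_cont_on_tr/mx_cont_on_invbasis.
Qed.

Lemma mx_cont_on_shift_prod (Q : pred 'I_n) :
  mx_cont_on P (fun z => shift_prod (A z) (lam^~ z) Q).
Proof.
rewrite /shift_prod; elim: (index_enum _) => [|r s IH].
  rewrite (_ : (fun z => _) = fun=> 1); first exact: mx_cont_on_cst.
  by apply/funext => z; rewrite big_nil.
rewrite (_ : (fun z => _) = fun z => (if Q r then A z - (lam r z)%:M else 1%:M) *m
    \prod_(r <- s | Q r) (A z - (lam r z)%:M)).
  apply: mx_cont_onM IH; case: (Q r); last exact: mx_cont_on_cst.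
  by apply: mx_cont_onB; [exact: cA|exact: mx_cont_on_scalar].
by apply/funext => z; rewrite big_cons; case: (Q r); rewrite ?mul1mx.
Qed.

Lemma mx_cont_on_nf_S : mx_cont_on P (fun z => nf_S kap e (A z) (B z)).
Proof.
apply: mx_cont_on_rows => i; case: chain_last => [s|]; last exact: mx_cont_on_cst.
apply: mx_cont_onM; last exact: cB.
apply: mx_cont_onM; last exact: mx_cont_onX.
exact/mx_cont_on_row/mx_cont_on_tr/mx_cont_on_invbasis.
Qed.

Lemma mx_cont_on_nf_F : mx_cont_on P (fun z => nf_F kap e (A z) (B z) (lam^~ z)).
Proof.
apply: mx_cont_on_rows => i.
by apply: mx_cont_onM; [exact: mx_cont_on_dual|exact: mx_cont_on_shift_prod].
Qed.

Lemma mx_cont_on_nf_T : mx_cont_on P (fun z => nf_T kap e (A z) (B z) (lam^~ z)).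
Proof.
apply: mx_cont_on_rows => r.
by apply: mx_cont_onM; [exact: mx_cont_on_dual|exact: mx_cont_on_shift_prod].
Qed.

End NormalFormCont.

(** Under a common input to all channels, the transformed system splits into [n] scalar systems with
    freely prescribed distinct eigenvalues. *)
Lemma diagonal_normal_form (R : realType) (n m : nat) (P : set R[i])
    (A : R[i] -> 'M[R[i]]_n) (B : R[i] -> 'M[R[i]]_(n, m)) (lam : 'I_n -> R[i] -> R[i]) :
  mx_cont_on P A -> mx_cont_on P B ->
  (forall th, P th -> reachable (A th) (B th)) ->
  (forall th1 th2, P th1 -> P th2 ->
     forall i : 'I_m, kronecker_indices (A th1) (B th1) i = kronecker_indices (A th2) (B th2) i) ->
  (forall r, {within P, continuous (lam r)}) ->
  (forall th, P th -> injective (lam^~ th)) ->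
  exists (T : R[i] -> 'M[R[i]]_n) (F : R[i] -> 'M[R[i]]_(m, n)) (S : R[i] -> 'M[R[i]]_m),
    [/\ restricted_feedback P T F S,
      forall th, P th -> fb_A T F S A B th = diag_mx (\row_r lam r th)
    & forall th, P th -> forall x, fb_B T F S B th *m const_mx x = const_mx x :> 'cV_n].
Proof.
move=> cA cB reach kapE clam lam_inj.
(* If [P] is empty, there is no point at which to read off the indices, and the pointwise
   requirements are void. *)
have [[z0 Pz0]|nP] := pselect (exists z, P z); last first.
  exists (fun=> 1%:M), (fun=> 0), (fun=> 1%:M).
  have nPz z : P z -> False by move=> Pz; apply: nP; exists z.
  split=> [|th /nPz //|th /nPz //].
  by split; [split; exact: mx_cont_on_cst|exact: mx_cont_on_cst| | |] => th /nPz.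
case: n => [|n'] in A B lam cA cB reach kapE clam lam_inj *.
  exists (fun=> 1%:M), (fun=> 0), (fun=> 1%:M).
  split=> [|th _|th _ x]; [|by apply/matrixP => -[]|by apply/matrixP => -[]].
  split; [split; exact: mx_cont_on_cst|exact: mx_cont_on_cst| | |] => th _.
  - exact: unitmx1.
  - by move=> i j ij; rewrite mxE; case: eqP ij => // ->; rewrite ltnn.
  - by move=> i; rewrite mxE eqxx.
(* By constancy of the indices, the enumeration [e] obtained at [z0] serves every parameter. *)
pose kap := kronecker_indices (A z0) (B z0).
pose J := [pred p : 'I_n'.+1 * 'I_m | (p.1 < kap p.2)%N].
have cardJ : #|J| = n'.+1 := card_selected (reach _ Pz0).
pose e (r : 'I_n'.+1) := enum_val (cast_ord (esym cardJ) r).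
have e_inj : injective e by move=> r s /enum_val_inj/cast_ord_inj.
have e_im (p : 'I_n'.+1 * 'I_m) : (p.1 < kap p.2)%N = (p \in codom e).
  apply/idP/codomP => [Jp|[r ->]]; last exact: (enum_valP (cast_ord (esym cardJ) r)).
  exists (cast_ord cardJ (enum_rank_in (A := J) Jp p)).
  by rewrite /e cast_ordK enum_rankK_in.
have kE z (Pz : P z) : forall i, kronecker_indices (A z) (B z) i = kap i.
  by move=> i; exact: kapE.
have bu z (Pz : P z) : selected_basis (A z) (B z) e \in unitmx.
  apply: (selected_basis_unit (reach _ Pz)) => p.
  by rewrite (kE z Pz) (e_im p).
exists (fun z => nf_T kap e (A z) (B z) (lam^~ z)),
  (fun z => nf_F kap e (A z) (B z) (lam^~ z)), (fun z => nf_S kap e (A z) (B z)).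
split.
- split.
  + by split; [exact: mx_cont_on_nf_T|exact: mx_cont_on_nf_F].
  + exact: mx_cont_on_nf_S.
  + move=> z Pz.
    exact: (nf_T_unit (reach z Pz) (kE z Pz) e_inj e_im (lam_inj z Pz)).
  + move=> z Pz i j; exact: (nf_S_trig (reach z Pz) (kE z Pz) e_im).
  + move=> z Pz i; exact: (nf_S_diag (reach z Pz) (kE z Pz) e_im).
- move=> z Pz.
  exact: (nf_closed_loop_A (reach z Pz) (kE z Pz) e_inj e_im (lam_inj z Pz)).
- move=> z Pz x.
  rewrite /fb_B (nf_closed_loop_B (lam^~ z) (reach z Pz) (kE z Pz) e_inj e_im).
  exact: nf_B_const.
Qed.

(** Continuity of the inverse comes from compactness: the parameters at distance at least [eps] from
    [t z] form a compact set, whose image is closed and misses [z] by injectivity. Points of [P]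
    near [z] thus have parameters within [eps] of [t z]. *)
Lemma jordan_arc_param (R : realType) (P : set R[i]) : jordan_arc P ->
  exists (gamma : R -> R[i]) (t : R[i] -> R),
    [/\ {within `[0, 1], continuous gamma}, {within P, continuous t},
      forall z, P z -> 0 <= t z <= 1 /\ gamma (t z) = z
    & forall x, 0 <= x <= 1 -> P (gamma x) /\ t (gamma x) = x].
Proof.
move=> [gamma [cg gi PE]].
have /choice[t tP] : forall z, exists x, P z -> 0 <= x <= 1 /\ gamma x = z.
  move=> z; have [Pz|nPz] := pselect (P z); last by exists 0.
  by move: (Pz); rewrite PE => -[x /= x01 <-]; exists x; rewrite in_itv /= in x01.
have Pg x : 0 <= x <= 1 -> P (gamma x).
  by move=> x01; rewrite PE; exists x => //=; rewrite in_itv.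
exists gamma, t; split => //; last first.
  by move=> x x01; split; [exact: Pg|have [? ?] := tP _ (Pg _ x01); exact: gi].
apply/subspace_continuousP => z Pz; apply/cvgrPdist_lt => eps eps0.
have [tz01 gtz] := tP z Pz.
pose K := `[0, 1] `&` [set x : R | eps <= `|t z - x|].
have cK : compact K.
  apply: compact_closedI; first exact: segment_compact.
  apply: (@closed_comp _ _ (fun x : R => `|t z - x|) [set y | eps <= y]).
    by move=> x _; apply: cvg_norm; apply: cvgB; [exact: cvg_cst|exact: cvg_id].
  exact: closed_ge.
have clK : closed (gamma @` K).
  apply: compact_closed; first exact: (@norm_hausdorff R[i] R[i]^o).
  apply: continuous_compact cK.
  by apply: continuous_subspaceW cg => x [].
have nz : (~` (gamma @` K)) z.
  move=> [x [/=]]; rewrite in_itv /= => x01 ex gx; move: ex.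
  by rewrite (gi x (t z)) ?gx ?gtz // subrr normr0 leNgt eps0.
have := open_nbhs_nbhs (conj (closed_openC clK) nz).
rewrite /within /=; apply: filterS => w nKw Pw.
rewrite ltNge; apply/negP => le; apply: nKw.
by exists (t w); have [? ?] := tP w Pw => //; split => //=; rewrite in_itv.
Qed.

(** * Polynomial approximation *)

Section Bernstein.
Variable R : realType.

(* The [N]-th Bernstein operator applied to the values [phi 0, ..., phi N], written
   through the recursion given by one coin toss rather than through binomials. *)
Fixpoint bernstein (N : nat) (phi : nat -> R) : {poly R} :=
  if N is N'.+1 then (1 - 'X) * bernstein N' phi + 'X * bernstein N' (phi \o succn)
  else (phi 0%N)%:P.

Lemma bernsteinS N phi x : (bernstein N.+1 phi).[x] =
  (1 - x) * (bernstein N phi).[x] + x * (bernstein N (phi \o succn)).[x].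
Proof. by rewrite /= !hornerE. Qed.

Lemma le_bernstein N phi psi x : 0 <= x <= 1 ->
  (forall k, (k <= N)%N -> phi k <= psi k) ->
  (bernstein N phi).[x] <= (bernstein N psi).[x].
Proof.
move=> /andP[x0 x1]; elim: N phi psi => [|N IH] phi psi le.
  by rewrite /= !hornerC le.
rewrite !bernsteinS lerD // ler_wpM2l ?subr_ge0 //; apply: IH => k kN; apply: le => //.
exact: leqW.
Qed.

Lemma bernstein_affine N (a b : R) phi x :
  (bernstein N (fun k => a + b * phi k)).[x] = a + b * (bernstein N phi).[x].
Proof.
elim: N phi => [|N IH] phi; first by rewrite /= !hornerC.
by rewrite !bernsteinS IH (IH (phi \o succn)); ring.
Qed.

(** Second moment about [c] of the number of heads in [N] tosses: squared bias plus variance. A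
    first toss showing heads replaces [c] by [c - 1]. *)
Lemma bernstein_variance N (c : R) x :
  (bernstein N (fun k => (k%:R - c) ^+ 2)).[x] =
  (N%:R * x - c) ^+ 2 + N%:R * x * (1 - x).
Proof.
elim: N c => [|N IH] c; first by rewrite /= hornerC; ring.
rewrite bernsteinS IH (_ : _ \o succn = fun k => (k%:R - (c - 1)) ^+ 2).
  by rewrite IH -natr1; ring.
by apply/funext => k /=; rewrite -natr1; ring.
Qed.

End Bernstein.

Section Weierstrass.
Variable R : realType.

(** Uniform continuity in a form suited to second moments. The pairs with [eps <= |g y - g x|] form
    a compact set off the diagonal, where the quotient by [(y - x)^2] attains a maximum [M]; for
    other pairs [eps] suffices. *)
Lemma continuous_quadratic_modulus (g : R -> R) (eps : R) :
  continuous g -> 0 < eps ->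
  exists2 M : R, 0 <= M & forall x y, 0 <= x <= 1 -> 0 <= y <= 1 ->
    `|g y - g x| <= eps + M * (y - x) ^+ 2.
Proof.
move=> cg eps0.
have cd : continuous (fun p : R * R => `|g p.2 - g p.1|).
  move=> p; apply: cvg_norm; apply: cvgB.
    by apply: continuous_cvg; [exact: cg|exact: cvg_snd].
  by apply: continuous_cvg; [exact: cg|exact: cvg_fst].
pose K := (`[0, 1] `*` `[0, 1]) `&` [set p : R * R | eps <= `|g p.2 - g p.1|].
have cK : compact K.
  apply: compact_closedI.
    by apply: compact_setX; exact: segment_compact.
  apply: (@closed_comp _ _ (fun p : R * R => `|g p.2 - g p.1|) [set y | eps <= y]).
    by move=> p _; exact: cd.
  exact: closed_ge.
have ineq (p : R * R) : K p -> p.2 - p.1 != 0.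
  move=> [_ /=]; apply: contraTneq => /eqP; rewrite subr_eq0 => /eqP ->.
  by rewrite subrr normr0 -ltNge.
have [[p0 Kp0]|nK] := pselect (K !=set0); last first.
  exists 0 => // x y x01 y01; rewrite mul0r addr0 leNgt; apply/negP => /ltW le.
  by apply: nK; exists (x, y); split; [split|]; rewrite //= in_itv.
have [|||c /set_mem Kc cmax] := @compact_EVT_max _ R
    (fun p : R * R => `|g p.2 - g p.1| * ((p.2 - p.1) ^+ 2)^-1) K.
- by exists p0.
- exact: cK.
- apply/subspace_continuousP => p Kp; apply: cvg_within_filter.
  apply: cvgM; first exact: cd.
  apply: cvgV; first by rewrite expf_neq0 // ineq.
  by apply: cvgM; apply: cvgB; [exact: cvg_snd|exact: cvg_fst|exact: cvg_snd|exact: cvg_fst].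
exists (`|g c.2 - g c.1| * ((c.2 - c.1) ^+ 2)^-1).
  by rewrite mulr_ge0 // invr_ge0 sqr_ge0.
move=> x y x01 y01; have [le|lt] := leP eps `|g y - g x|; last first.
  apply: (le_trans (ltW lt)); rewrite lerDl mulr_ge0 ?sqr_ge0 //.
  by rewrite mulr_ge0 // invr_ge0 sqr_ge0.
have Kxy : K (x, y) by split; [split|]; rewrite //= in_itv.
have := cmax (x, y) (mem_set Kxy); rewrite /= ler_pdivrMr; last first.
  by rewrite lt0r sqrf_eq0 (ineq _ Kxy) sqr_ge0.
by move=> /le_trans; apply; rewrite lerDr ltW.
Qed.

(** The Bernstein operator turns the quadratic bound on [|g (k / N) - g x|] into
    [eps / 2 + (M / N) x (1 - x)], and [N] is chosen so that [M / N <= eps / 2]. *)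
Lemma weierstrass01 (g : R -> R) (eps : R) : continuous g -> 0 < eps ->
  exists p : {poly R}, forall x, 0 <= x <= 1 -> `|p.[x] - g x| <= eps.
Proof.
move=> cg eps0; have eps20 : 0 < eps / 2 by rewrite divr_gt0.
have [M M0 gM] := continuous_quadratic_modulus cg eps20.
pose N := (Num.bound (2 * M / eps)).+1.
have N0 : 0 < N%:R :> R by rewrite ltr0n.
have NM : M / N%:R <= eps / 2.
  rewrite ler_pdivrMr // mulrAC ler_pdivlMr //.
  have : 2 * M / eps < N%:R.
    apply: (lt_trans (archi_boundP _)); last by rewrite ltr_nat.
    by rewrite divr_ge0 ?mulr_ge0 // ltW.
  by rewrite ltr_pdivrMr // => /ltW; rewrite mulrC (mulrC eps).
exists (bernstein N (fun k => g (k%:R / N%:R))) => x x01.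
have bound : (bernstein N (fun k =>
    eps / 2 + M / N%:R ^+ 2 * (k%:R - N%:R * x) ^+ 2)).[x] <= eps.
  rewrite bernstein_affine bernstein_variance subrr expr0n add0r.
  have -> : M / N%:R ^+ 2 * (N%:R * x * (1 - x)) = M / N%:R * (x * (1 - x)).
    by field; rewrite gt_eqF.
  rewrite [leRHS](splitr eps) lerD2l (le_trans _ NM) //.
  rewrite ler_piMr ?divr_ge0 //; last first.
  by move: x01 => /andP[x0 x1]; nra.
have dist k : (k <= N)%N -> `|g (k%:R / N%:R) - g x| <=
    eps / 2 + M / N%:R ^+ 2 * (k%:R - N%:R * x) ^+ 2.
  move=> kN; have /(le_trans (gM x (k%:R / N%:R) x01 _)) -> // :
    eps / 2 + M * (k%:R / N%:R - x) ^+ 2 <=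
    eps / 2 + M / N%:R ^+ 2 * (k%:R - N%:R * x) ^+ 2.
    rewrite lerD2l le_eqVlt; apply/orP; left; apply/eqP.
    by field; rewrite gt_eqF.
  by rewrite divr_ge0 //= ler_pdivrMr // mul1r ler_nat.
(* The values [s = -1] and [s = 1] give the two halves of the absolute value bound. *)
have lin (s : R) : (bernstein N (fun k => - (s * g x) + s * g (k%:R / N%:R))).[x] =
    s * ((bernstein N (fun k => g (k%:R / N%:R))).[x] - g x).
  by rewrite bernstein_affine; ring.
rewrite ler_norml; apply/andP; split.
  rewrite lerNl -mulN1r -lin (le_trans _ bound) //.
  apply: le_bernstein => // k /dist; apply: le_trans.
  by rewrite !mulN1r opprK distrC ler_norm.
rewrite -[leLHS]mul1r -lin (le_trans _ bound) //.
apply: le_bernstein => // k /dist; apply: le_trans.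
by rewrite !mul1r addrC ler_norm.
Qed.

Lemma weierstrass (g : R -> R) (b eps : R) : continuous g -> 0 < b -> 0 < eps ->
  exists p : {poly R}, forall x, 0 <= x <= b -> `|p.[x] - g x| <= eps.
Proof.
move=> cg b0 eps0.
have [|p pP] := @weierstrass01 (fun x => g (b * x)) eps _ eps0.
  move=> x; apply: (@continuous_comp _ _ _ (fun x => b * x) g); last exact: cg.
  exact: mulrl_continuous.
exists (p \Po (b^-1 *: 'X)) => x /andP[x0 xb].
rewrite horner_comp hornerZ hornerX.
have := pP (b^-1 * x); rewrite mulrA mulfV ?gt_eqF // mul1r; apply.
by rewrite mulr_ge0 ?invr_ge0 ?(ltW b0) //= mulrC ler_pdivrMr // mul1r.
Qed.

End Weierstrass.

(** * Real part, imaginary part and the embedding of the real line *)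

Section ComplexTopology.
Variable R : realType.
Local Notation C := R[i].

Lemma normc_le_Re_Im (a b : R) : `|Complex a b| <= (`|a| + `|b|)%:C%C.
Proof.
rewrite normc_def lecR /= -[leRHS]ger0_norm ?addr_ge0 // -sqrtr_sqr ler_wsqrtr //.
by rewrite sqrrD !real_normK ?num_real // lerD2r lerDl mulrn_wge0 // mulr_ge0.
Qed.

Lemma continuous_Re : continuous (fun z : C => complex.Re z : R).
Proof.
move=> z; apply: (@cvgrPdist_lt _ _ _ (nbhs (z : C)) (@nbhs_filter C^o z) _ _).2 => eps eps0.
apply/(@nbhs_ballP C C^o); exists eps%:C%C; first by rewrite /= ltcR.
move=> w; rewrite -ball_normE /= -ltcR.
apply: le_lt_trans; have := normc_ge_Re (z - w).
by case: z w => [a b] [c d].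
Qed.

Lemma continuous_Im : continuous (fun z : C => complex.Im z : R).
Proof.
move=> z; apply: (@cvgrPdist_lt _ _ _ (nbhs (z : C)) (@nbhs_filter C^o z) _ _).2 => eps eps0.
apply/(@nbhs_ballP C C^o); exists eps%:C%C; first by rewrite /= ltcR.
move=> w; rewrite -ball_normE /= -ltcR.
apply: le_lt_trans; case: z w => [a b] [c d] /=.
by rewrite normc_def lecR /= -sqrtr_sqr ler_wsqrtr // lerDr sqr_ge0.
Qed.

Lemma continuous_real_complex : continuous (fun x : R => (x%:C)%C : C).
Proof.
move=> x; apply/(@cvgrPdist_lt C C^o) => eps eps0.
(* In the order of [C], a positive element is real. *)
have [epsR epsE] : 0 < complex.Re eps /\ eps = (complex.Re eps)%:C%C.
  by move: eps0; rewrite ltcE /= => /andP[/eqP im re]; case: eps im re => [a b] /= ->.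
have /cvgrPdist_lt/(_ _ epsR) : (fun w : R => w) @ x --> x by exact: cvg_id.
apply: filterS => y; rewrite epsE -ltcR; apply: le_lt_trans.
by rewrite -rmorphB normc_def /= expr0n addr0 sqrtr_sqr.
Qed.

End ComplexTopology.

Lemma within_continuous_comp (T U V : topologicalType) (A : set T) (D : set U)
    (f : U -> V) (g : T -> U) : (forall x, A x -> D (g x)) ->
  {within A, continuous g} -> {within D, continuous f} ->
  {within A, continuous (f \o g)}.
Proof.
move=> AD /subspace_continuousP cg /subspace_continuousP cf.
apply/subspace_continuousP => x Ax; apply: (@cvg_comp _ _ _ g f) (cf _ (AD _ Ax)).
move=> Q; rewrite /within /= => nQ.
have := cg _ Ax _ nQ; rewrite /nbhs /= /within /=.
by apply: filterS => y DQ Ay; apply: DQ => //; exact: AD.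
Qed.

(** * Simultaneous approximation of several functions by one polynomial *)

Section PolynomialDensity.
Variable R : realType.
Local Notation C := R[i].

(** [clamp] serves to extend functions on [[0, 1]] continuously to the line; [bump] is 1 on [[0, 1]]
    and 0 at distance at least 1 from it, which cuts the extension off before it meets the segment
    of another index. *)
Let clamp (y : R) := Num.max 0 (Num.min 1 y).
Let bump (y : R) := Num.max 0 (1 - `|y - clamp y|).

Let clamp01 y : 0 <= clamp y <= 1.
Proof. by rewrite /clamp le_max lexx /= ge_max ler01 ge_min lexx. Qed.

Let clamp_id y : 0 <= y <= 1 -> clamp y = y.
Proof. by move=> /andP[y0 y1]; rewrite /clamp min_r // max_r. Qed.

Let bump1 y : 0 <= y <= 1 -> bump y = 1.
Proof. by move=> y01; rewrite /bump clamp_id // subrr normr0 subr0 max_r. Qed.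

Let bump0 y : y <= -1 \/ 2 <= y -> bump y = 0.
Proof.
move=> y12; rewrite /bump /clamp max_l // subr_le0.
case: y12 => [ym1|y2].
  rewrite min_r ?max_l; [|lra..].
  by rewrite subr0 ler0_norm; lra.
rewrite min_l ?max_r; [|lra..].
by rewrite ger0_norm; lra.
Qed.

Let clamp_cont : continuous clamp.
Proof.
have -> : clamp = (fun=> 0) \max ((fun=> 1) \min id) by [].
move=> y; apply: continuous_max; first exact: cvg_cst.
by apply: continuous_min; [exact: cvg_cst|exact: cvg_id].
Qed.

Let bump_cont : continuous bump.
Proof.
have -> : bump = (fun=> 0) \max (fun y => 1 - `|y - clamp y|) by [].
move=> y; apply: continuous_max; first exact: cvg_cst.
apply: cvgB; first exact: cvg_cst.
by apply: cvg_norm; apply: cvgB; [exact: cvg_id|exact: clamp_cont].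
Qed.

(* The nodes [x + 2r + 2], for [0 <= x <= 1], sweep pairwise disjoint segments, one for
   each [r], so that one continuous function on the line prescribes all [F r] at once. *)
Definition node (r : nat) (x : R) : R := x + (2 * r%:R + 2).

Lemma poly_dense_nodes n (F : 'I_n -> R -> R) (eps : R) :
  (forall r, {within `[0, 1], continuous (F r)}) -> 0 < eps ->
  exists p : {poly R}, forall (r : 'I_n) x, 0 <= x <= 1 ->
    `|p.[node r x] - F r x| <= eps.
Proof.
move=> cF eps0.
pose shift (r : nat) (x : R) := x - (2 * r%:R + 2).
pose g x := \sum_(r < n) F r (clamp (shift r x)) * bump (shift r x).
have cg : continuous g.
  move=> x; rewrite /g; apply: cvg_big => [|r _]; first exact: add_continuous.
  have cs : continuous (shift r).
    by move=> y; apply: cvgB; [exact: cvg_id|exact: cvg_cst].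
  apply: cvgM; last by apply: (@continuous_comp _ _ _ (shift r) bump); [exact: cs|exact: bump_cont].
  suff : continuous (F r \o (clamp \o shift r)) by apply.
  apply/continuous_subspace_setT; apply: within_continuous_comp (cF r).
    by move=> y _ /=; rewrite in_itv /=; exact: clamp01.
  apply: continuous_subspaceT => y.
  by apply: (@continuous_comp _ _ _ (shift r) clamp); [exact: cs|exact: clamp_cont].
(* All nodes lie between 0 and [2 n + 1]. *)
have [|p pP] := weierstrass cg (b := 2 * n%:R + 2) _ eps0; first by rewrite ltr_wpDl ?mulr_ge0.
exists p => r x x01.
have -> : F r x = g (node r x).
  rewrite /g (bigD1 r) //= /shift /node addrK clamp_id // bump1 // mulr1.
  (* For [s <> r] the argument of [bump] is [x + 2 (r - s)], which is at most -1 or at least 2. *)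
  rewrite big1 ?addr0 // => s sr; rewrite bump0 ?mulr0 //.
  move: x01 => /andP[x0 x1]; have [lt|gt|/val_inj eq] := ltngtP r s; last by rewrite eq eqxx in sr.
    left; have : (r.+1)%:R <= s%:R :> R by rewrite ler_nat.
    by rewrite -natr1; lra.
  right; have : (s.+1)%:R <= r%:R :> R by rewrite ler_nat.
  by rewrite -natr1; lra.
move: x01 => /andP[x0 x1]; apply: pP; rewrite /node; have : (r.+1)%:R <= n%:R :> R by rewrite ler_nat.
have : 0 <= r%:R :> R by [].
by rewrite -natr1 => r0 rn; apply/andP; split; lra.
Qed.

(** Real and imaginary parts are pulled back to [[0, 1]] by [gamma] and approximated separately. As
    the nodes are real, the two real polynomials act as one complex polynomial. *)
Lemma poly_dense_arc n (P : set C) (gamma : R -> C) (t : C -> R)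
    (f : 'I_n -> C -> C) (eps : R) :
  {within `[0, 1], continuous gamma} ->
  (forall z, P z -> 0 <= t z <= 1 /\ gamma (t z) = z) ->
  (forall x, 0 <= x <= 1 -> P (gamma x)) ->
  (forall r, {within P, continuous (f r)}) -> 0 < eps ->
  exists p1 p2 : {poly R}, forall (r : 'I_n) z, P z ->
    `|Complex p1.[node r (t z)] p2.[node r (t z)] - f r z| <= eps%:C%C.
Proof.
move=> cg tP Pg cf eps0; have eps20 : 0 < eps / 2 by rewrite divr_gt0.
have cfg r : {within `[0, 1], continuous (f r \o gamma)}.
  apply: within_continuous_comp (cf r) => // x; rewrite /= in_itv; exact: Pg.
have cR r : {within `[0, 1], continuous ((fun z : C => complex.Re z : R) \o (f r \o gamma))}.
  exact: (@within_continuous_comp _ _ _ _ setT (fun z : C => complex.Re z : R)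
    (f r \o gamma) (fun _ _ => I) (cfg r) (continuous_subspaceT (@continuous_Re R))).
have cI r : {within `[0, 1], continuous ((fun z : C => complex.Im z : R) \o (f r \o gamma))}.
  exact: (@within_continuous_comp _ _ _ _ setT (fun z : C => complex.Im z : R)
    (f r \o gamma) (fun _ _ => I) (cfg r) (continuous_subspaceT (@continuous_Im R))).
have [p1 p1P] := poly_dense_nodes cR eps20.
have [p2 p2P] := poly_dense_nodes cI eps20.
exists p1, p2 => r z Pz; have [t01 gt] := tP z Pz.
have := p1P r _ t01; have := p2P r _ t01; rewrite /= gt.
case: (f r z) => [a b] /= h2 h1.
apply: (le_trans (normc_le_Re_Im _ _)); rewrite lecR (splitr eps).
exact: lerD.
Qed.

End PolynomialDensity.

(** * Responses to step inputs *)

Section StepInputs.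
Variable R : realType.
Local Notation mu := (@lebesgue_measure R).

(* Neighbouring steps overlap at integers, a null set. *)
Definition step_fun (c : nat -> R) (N : nat) (s : R) : R :=
  \sum_(k < N) c k * ((fun _ : R => 1 : R) \_ `[k%:R, k.+1%:R]) s.

(** The number [M] of steps is kept apart from [N] so that the induction leaves the domain of
    integration fixed. *)
Lemma step_fun_integral (h : R -> R) (c : nat -> R) (M N : nat) : (M <= N)%N ->
  continuous h ->
  mu.-integrable `[0, N%:R] (EFin \o (fun s => h s * step_fun c M s)) /\
  Rintegral mu `[0, N%:R] (fun s => h s * step_fun c M s) =
    \sum_(k < M) c k * Rintegral mu `[k%:R, k.+1%:R] h.
Proof.
move=> + ch; have mN : measurable (`[0, N%:R] : set R) by exact: measurable_itv.
elim: M => [_|M IH lt].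
  rewrite (_ : (fun s => _) = cst 0); last first.
    by apply/funext => s; rewrite /step_fun big_ord0 mulr0.
  by rewrite big_ord0 Rintegral_cst // mul0r; split => //; exact: integrable0.
have [iM EM] := IH (ltnW lt).
have sub : `[0, N%:R] `&` `[M%:R, M.+1%:R] = (`[M%:R, M.+1%:R] : set R).
  apply/setIidPr => s /=; rewrite !in_itv /= => /andP[s0 s1].
  by rewrite (le_trans _ s0) //= (le_trans s1) // ler_nat.
have mM : measurable (`[M%:R, M.+1%:R] : set R) by exact: measurable_itv.
have ih : mu.-integrable `[0, N%:R] (EFin \o (h \_ `[M%:R, M.+1%:R])).
  rewrite -restrict_EFin; apply/integrable_restrict => //; rewrite sub.
  apply: continuous_compact_integrable; first exact: segment_compact.
  exact: continuous_subspaceT.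
have ich : mu.-integrable `[0, N%:R] (EFin \o (fun s => c M * (h \_ `[M%:R, M.+1%:R]) s)).
  rewrite (_ : EFin \o _ = (fun s => (c M)%:E * (EFin \o h \_ `[M%:R, M.+1%:R]) s)%E).
    exact: integrableZl.
  by apply/funext => s; rewrite /= EFinM.
have E : (fun s => h s * step_fun c M.+1 s) =
    (fun s => h s * step_fun c M s + c M * (h \_ `[M%:R, M.+1%:R]) s).
  apply/funext => s; rewrite /step_fun big_ord_recr /= mulrDr; congr (_ + _).
  by rewrite mulrCA; congr (_ * _); rewrite !patchE; case: ifP; rewrite ?mulr1 ?mulr0.
rewrite E; split.
  rewrite (_ : EFin \o _ = ((EFin \o (fun s => h s * step_fun c M s)%R) \+
      (EFin \o (fun s => c M * (h \_ `[M%:R, M.+1%:R]) s)%R))%E).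
    exact: integrableD.
  by apply/funext => s; rewrite /= EFinD.
rewrite RintegralD // EM big_ord_recr /= RintegralZl //; congr (_ + _ * _).
by rewrite -Rintegral_mkcondr sub.
Qed.

Lemma Rintegral_expR (l a : R) (k : nat) : 0 < l ->
  Rintegral mu `[k%:R, k.+1%:R] (fun s => expR ((a - s) * l)) =
  expR ((a - k.+1%:R) * l) * (expR l - 1) / l.
Proof.
move=> l0; pose F (s : R) := - l^-1 * expR ((a - s) * l).
have dF (s : R) : is_derive s 1 F (expR ((a - s) * l)).
  have d1 : is_derive s 1 (fun s : R => (a - s) * l) (- l).
    apply: is_derive_eq; rewrite /GRing.scale /=; ring.
  have d2 := @is_derive1_comp _ expR (fun s : R => (a - s) * l) s _ _ (is_derive_expR _) d1.
  have -> : expR ((a - s) * l) = - l^-1 *: (expR ((a - s) * l) * - l).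
    by rewrite /GRing.scale /=; field; rewrite gt_eqF.
  exact: is_deriveZ.
have cexp : continuous (fun s : R => expR ((a - s) * l)).
  move=> s; apply: (@continuous_comp _ _ _ (fun s : R => (a - s) * l) expR).
    apply: cvgM; last exact: cvg_cst.
    by apply: cvgB; [exact: cvg_cst|exact: cvg_id].
  exact: continuous_expR.
have cF : continuous F.
  by move=> s; apply/differentiable_continuous/derivable1_diffP/ex_derive.
rewrite /Rintegral (@continuous_FTC2 _ _ F).
- rewrite -EFinB /= /F -natr1.
  have -> : (a - k%:R) * l = (a - (k%:R + 1)) * l + l by ring.
  by rewrite expRD; field; rewrite gt_eqF.
- by rewrite ltr_nat.
- exact: continuous_subspaceT.
- split.
  + by move=> s _; apply: ex_derive.
  + by apply: cvg_at_right_filter; exact: cF.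
  + by apply: cvg_at_left_filter; exact: cF.
- by move=> s _; rewrite derive1E; apply: derive_val.
Qed.

(** Step [k] contributes its coefficient times [x^(N - 1 - k)] times [(x - 1) / ln x]. The
    coefficients come in reverse order, so the powers match and the last factor is common to all
    steps. *)
Lemma step_response (p : {poly R}) (N : nat) (x : R) : (size p <= N)%N -> 1 < x ->
  Rintegral mu `[0, N%:R]
    (fun s => expR ((N%:R - s) * ln x) * step_fun (fun k => p`_(N.-1 - k)) N s) =
  p.[x] * ((x - 1) / ln x).
Proof.
move=> pN x1; have l0 := ln_gt0 x1.
have x0 : x \is Num.pos by rewrite posrE (lt_trans _ x1).
have ch : continuous (fun s : R => expR ((N%:R - s) * ln x)).
  move=> s; apply: (@continuous_comp _ _ _ (fun s : R => (N%:R - s) * ln x) expR).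
    apply: cvgM; last exact: cvg_cst.
    by apply: cvgB; [exact: cvg_cst|exact: cvg_id].
  exact: continuous_expR.
rewrite (step_fun_integral _ (leqnn N) ch).2.
rewrite (horner_coef_wide _ pN) mulr_suml (reindex_inj rev_ord_inj) /=.
apply: eq_bigr => k _; rewrite Rintegral_expR // lnK //.
have kN := ltn_ord k.
have -> : (N.-1 - (N - k.+1))%N = k by lia.
rewrite -natrB; last by lia.
have -> : (N - (N - k.+1).+1)%N = k by lia.
by rewrite expRM_natl lnK // -!mulrA.
Qed.

End StepInputs.

(** * Responses of a diagonal system to a common input *)

Section DiagonalResponse.
Variable R : realType.
Local Notation C := R[i].

Lemma real_complexM (x a b : R) : (x%:C)%C * Complex a b = Complex (x * a) (x * b).
Proof. by rewrite /GRing.mul /= !mul0r subr0 addr0. Qed.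

Lemma sum_Complex n (a b : 'I_n -> R) :
  \sum_(k < n) Complex (a k) (b k) = Complex (\sum_(k < n) a k) (\sum_(k < n) b k).
Proof. by elim/big_rec3: _ => // k x y z _ ->. Qed.

Lemma diag_mxX n (d : 'rV[C]_n) k i j :
  (diag_mx d ^+ k) i j = d 0 i ^+ k *+ (i == j).
Proof.
elim: k i j => [|k IH] i j; first by rewrite !expr0 mxE.
rewrite exprS -[_ * _]/(diag_mx d *m _) mul_diag_mx mxE IH exprS.
by rewrite mulrnAr.
Qed.

(** Off the diagonal the series vanishes; on it the real exponential series is carried to [C] by the
    continuous embedding. *)
Lemma expmx_diag n (y : 'I_n -> R) :
  expmx (diag_mx (\row_r (y r)%:C%C)) = diag_mx (\row_r (expR (y r))%:C%C).
Proof.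
apply/matrixP => i j; rewrite !mxE.
have [<-|ij] := eqVneq i j; last first.
  rewrite mulr0n (_ : (fun N : nat => _) = fun=> 0).
    by apply: (@cvg_lim C^o); [exact: norm_hausdorff|exact: cvg_cst].
  apply/funext => N; apply: big1 => k _.
  by rewrite diag_mxX (negPf ij) mulr0n mul0r.
rewrite mulr1n (_ : (fun N : nat => _) =
  (fun x : R => (x%:C)%C : C) \o series (exp_coeff (y i))).
  apply: (@cvg_lim C^o); first exact: norm_hausdorff.
  apply: continuous_cvg; first exact: continuous_real_complex.
  exact: is_cvg_series_exp_coeff.
apply/funext => N; rewrite /= /series /= big_mkord rmorph_sum; apply: eq_bigr => k _.
rewrite diag_mxX eqxx mulr1n mxE.
by rewrite [in RHS]/exp_coeff rmorphM fmorphV rmorphXn rmorph_nat.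
Qed.

(** The coefficients are reversed because the input at time [k] is multiplied by [A^(N - 1 - k)]. *)
Definition disc_input m (p1 p2 : {poly R}) (N k : nat) : 'cV[C]_m :=
  const_mx (Complex p1`_(N.-1 - k) p2`_(N.-1 - k)).

Definition cont_input m (p1 p2 : {poly R}) (N : nat) (s : R) : 'cV[C]_m :=
  const_mx (Complex (step_fun (fun k => p1`_(N.-1 - k)) N s)
                    (step_fun (fun k => p2`_(N.-1 - k)) N s)).

Variables (n m : nat) (P : set C) (A : C -> 'M[C]_n) (B : C -> 'M[C]_(n, m)).
Variable x : 'I_n -> C -> R.
Hypothesis BE : forall z, P z -> forall c, B z *m const_mx c = const_mx c :> 'cV_n.

Lemma reach_disc_diag (p1 p2 : {poly R}) N z (r : 'I_n) : P z ->
  A z = diag_mx (\row_r (x r z)%:C%C) ->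
  (size p1 <= N)%N -> (size p2 <= N)%N ->
  reach_disc A B N (disc_input m p1 p2 N) z r 0 =
  Complex p1.[x r z] p2.[x r z].
Proof.
move=> Pz AE s1 s2; rewrite /reach_disc /disc_input summxE.
rewrite (horner_coef_wide _ s1) (horner_coef_wide _ s2) -sum_Complex.
apply: eq_bigr => k _; have kN := ltn_ord k.
have -> : (N.-1 - (N.-1 - k))%N = k by lia.
rewrite -mulmxA BE // AE mxE (bigD1 r) //= big1 ?addr0 => [|j jr].
  rewrite diag_mxX eqxx mulr1n !mxE -rmorphXn /= real_complexM.
  by rewrite mulrC [X in Complex _ X]mulrC.
by rewrite diag_mxX eq_sym (negPf jr) mulr0n mul0r.
Qed.

(** The eigenvalue [ln x] makes the exponential a power of the node [x], so [step_response] applies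
    to the real and the imaginary part. *)
Lemma reach_cont_diag (p1 p2 : {poly R}) N z (r : 'I_n) : P z ->
  A z = diag_mx (\row_r (ln (x r z))%:C%C) -> 1 < x r z ->
  (size p1 <= N)%N -> (size p2 <= N)%N ->
  reach_cont A B N%:R (cont_input m p1 p2 N) z r 0 =
  ((x r z - 1) / ln (x r z))%:C%C * Complex p1.[x r z] p2.[x r z].
Proof.
move=> Pz AE x1 s1 s2; rewrite mxE real_complexM.
rewrite mulrC [X in Complex _ X]mulrC -!(@step_response _ _ N) //.
rewrite /cintegral; congr Complex; apply: eq_Rintegral => s _;
  have -> : (N%:R - s)%:C%C *: A z = diag_mx (\row_r ((N%:R - s) * ln (x r z))%:C%C).
1,3: by rewrite AE -linearZ /=; congr diag_mx; apply/rowP => j; rewrite !mxE rmorphM.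
all: rewrite expmx_diag -mulmxA BE // mul_diag_mx !mxE real_complexM //.
Qed.

End DiagonalResponse.

Lemma cintegrable_step (R : realType) (c d : nat -> R) (N : nat) :
  cintegrable (fun s => Complex (step_fun c N s) (step_fun d N s)) N%:R.
Proof.
have one (e : nat -> R) : (@lebesgue_measure R).-integrable `[0, N%:R]
    (EFin \o step_fun e N).
  have [+ _] := @step_fun_integral R (fun=> 1) e N N (leqnn N) (@cst_continuous _ _ _).
  by under [X in EFin \o X]eq_fun do rewrite mul1r.
by split; exact: one.
Qed.

(** * Uniform ensemble reachability in discrete and in continuous time *)

Unset Implicit Arguments.

Theorem mainTheorem3 (R : realType) (n m : nat) (P : set R[i])
    (A : R[i] -> 'M[R[i]]_n) (B : R[i] -> 'M[R[i]]_(n, m)) :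
  jordan_arc P ->
  mx_cont_on P A -> mx_cont_on P B ->
  (forall th, P th -> reachable (A th) (B th)) ->
  (forall th1 th2, P th1 -> P th2 ->
     forall i : 'I_m, kronecker_indices (A th1) (B th1) i = kronecker_indices (A th2) (B th2) i) ->
  (exists (T : R[i] -> 'M[R[i]]_n) (F : R[i] -> 'M[R[i]]_(m, n)) (S : R[i] -> 'M[R[i]]_m),
      restricted_feedback P T F S /\ uer_disc P (fb_A T F S A B) (fb_B T F S B)) /\
  (exists (T : R[i] -> 'M[R[i]]_n) (F : R[i] -> 'M[R[i]]_(m, n)) (S : R[i] -> 'M[R[i]]_m),
      restricted_feedback P T F S /\ uer_cont P (fb_A T F S A B) (fb_B T F S B)).
Proof.
move=> /jordan_arc_param[gamma [t [cg ct tP Pg]]] cA cB reach kapE.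
(* At each point of [P] the nodes are distinct, exceed 1, which makes their logarithms positive, and
   are at most [2 n + 1]. *)
pose x (r : 'I_n) z := node r (t z).
have x1 r z : P z -> 1 < x r z.
  move=> /tP[/andP[t0 _] _]; rewrite /x /node.
  by have : 0 <= (r : nat)%:R :> R by []; lra.
have xn r z : P z -> x r z <= 2 * n%:R + 1.
  move=> /tP[/andP[_ t1] _]; rewrite /x /node.
  have : (r.+1)%:R <= n%:R :> R by rewrite ler_nat.
  by rewrite -natr1; lra.
have x_inj z : injective (x^~ z).
  by move=> r s /addrI/addIr/mulfI; rewrite pnatr_eq0 => /(_ isT)/eqP; rewrite eqr_nat => /eqP/val_inj.
have cx r : {within P, continuous (x r)}.
  move=> z; apply: cvgD; [exact: ct|exact: cvg_cst].
have toC (g : R[i] -> R) : {within P, continuous g} ->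
    {within P, continuous (fun z => (g z)%:C%C)}.
  move=> cg'.
  exact: (@within_continuous_comp _ _ _ P setT (fun y : R => y%:C%C) g (fun _ _ => I) cg'
    (continuous_subspaceT (@continuous_real_complex R))).
have PgP y : 0 <= y <= 1 -> P (gamma y) by move=> /Pg[].
split.
- have [||T [F [S [TFS AE BE]]]] := diagonal_normal_form (lam := fun r z => (x r z)%:C%C)
    cA cB reach kapE.
  + by move=> r; exact: toC.
  + by move=> z _ r s [/x_inj].
  exists T, F, S; split => // f cf eps eps0.
  (* Halving is needed as [unif_close] asks for a bound strictly below [eps]. *)
  have e2 : 0 < eps / 2 by rewrite divr_gt0.
  have [p1 [p2 pP]] := poly_dense_arc cg tP PgP (fun r => cf r 0) e2.
  pose N := maxn (size p1) (size p2).
  exists N, (disc_input m p1 p2 N), (eps / 2); split; first by lra.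
  move=> z Pz r; rewrite (reach_disc_diag (x := x) BE r Pz (AE z Pz)).
  + exact: pP.
  + exact: leq_maxl.
  + exact: leq_maxr.
- have lx0 r z : P z -> 0 < ln (x r z) by move=> Pz; rewrite ln_gt0 // x1.
  have cln r : {within P, continuous (fun z => ln (x r z))}.
    have /subspace_continuousP cx' := cx r.
    apply/subspace_continuousP => z Pz; apply: cvg_comp (cx' z Pz) _.
    by apply: continuous_ln; have := x1 r z Pz; lra.
  have [||T [F [S [TFS AE BE]]]] := diagonal_normal_form
    (lam := fun r z => (ln (x r z))%:C%C) cA cB reach kapE.
  + by move=> r; exact: toC.
  + move=> z Pz r s [/ln_inj]; rewrite !posrE => xx; apply: x_inj; apply: xx.
      by have := x1 r z Pz; lra.
    by have := x1 s z Pz; lra.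
  exists T, F, S; split => // f cf eps eps0.
  (* [w] is the factor between the continuous-time response and the polynomial, so the functions to
     approximate are the entries of [f] divided by [w]. *)
  pose w r z := (x r z - 1) / ln (x r z).
  have w0 r z : P z -> 0 < w r z.
    by move=> Pz; rewrite divr_gt0 ?lx0 // subr_gt0 x1.
  (* From [exp (- ln x) >= 1 - ln x] follows [x - 1 <= x ln x], that is, [w <= x]. *)
  have wn r z : P z -> w r z <= 2 * n%:R + 1.
    move=> Pz; apply: le_trans (xn r z Pz); rewrite ler_pdivrMr ?lx0 //.
    have xp : 0 < x r z by have := x1 r z Pz; lra.
    have := expR_ge1Dx (- ln (x r z)); rewrite expRN lnK ?posrE //.
    rewrite -(ler_pM2l xp) mulfV ?gt_eqF // mulrDr mulr1 mulrN; lra.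
  have K0 : 0 < 2 * n%:R + 1 :> R by rewrite ltr_wpDl ?mulr_ge0.
  (* Multiplication by [w <= 2 n + 1] enlarges an error [e1] to at most [eps / 2]. *)
  pose e1 := eps / 2 / (2 * n%:R + 1).
  have e10 : 0 < e1 by rewrite !divr_gt0.
  have cfw r : {within P, continuous (fun z => f z r 0 * ((w r z)^-1)%:C%C)}.
    apply: cont_onM; first exact: cf.
    apply: (@eq_cont_on _ _ (fun z => (ln (x r z))%:C%C * ((x r z + -1)%:C%C)^-1)).
      by move=> z _; rewrite -fmorphV -rmorphM /w invf_div.
    apply: cont_onM; first exact: toC.
    apply: cont_onV.
      by move=> z Pz; rewrite fmorph_eq0 gt_eqF // subr_gt0 x1.
    by apply: toC => z; apply: cvgD; [exact: cx|exact: cvg_cst].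
  have [p1 [p2 pP]] := poly_dense_arc cg tP PgP cfw e10.
  (* The successor keeps the final time positive even if both polynomials are zero. *)
  pose N := (maxn (size p1) (size p2)).+1.
  exists N%:R, (cont_input m p1 p2 N); split.
  + by rewrite ltr0n.
  + move=> j; rewrite (_ : (fun s => _) = fun s => Complex
      (step_fun (fun k => p1`_(N.-1 - k)) N s) (step_fun (fun k => p2`_(N.-1 - k)) N s)).
      exact: cintegrable_step.
    by apply/funext => s; rewrite mxE.
  exists (eps / 2); split; first by lra.
  move=> z Pz r; rewrite (reach_cont_diag (x := x) BE (r := r) Pz (AE z Pz) (x1 r z Pz)).
  + have -> : f z r 0 = (w r z)%:C%C * (f z r 0 * ((w r z)^-1)%:C%C).
      by rewrite mulrCA -rmorphM mulfV ?mulr1 // gt_eqF // w0.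
    rewrite -mulrBr normrM.
    have -> : `|((w r z)%:C)%C| = (w r z)%:C%C by rewrite ger0_norm // lecR ltW // w0.
    have -> : eps / 2 = (2 * n%:R + 1) * e1.
      by rewrite [RHS]mulrC /e1 divfK // gt_eqF.
    rewrite [leRHS]rmorphM /=; apply: (@ler_pM R[i]) => //; last exact: pP.
    * by rewrite lecR ltW // w0.
    * by rewrite lecR wn.
  + exact/leqW/leq_maxl.
  + exact/leqW/leq_maxr.
Qed.
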